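(* Let $k\ge 2$ and $n$ be positive integers. If $\gcd(k,n)=1$, then for each $s\in\mathbb{Z}_n$, \[ m(k,n;s)=\max_{d\mid n}\left(\left\lfloor\frac{d-2}{k}\right\rfloor+1\right)\frac{n}{d}, \] where the maximum is over all positive divisors $d$ of $n$.
   Context: $\mathbb{Z}_n=\mathbb{Z}/n\mathbb{Z}$. For $B\subset\mathbb{Z}_n$, the $k$-fold sumset is $kB=\{b_1+\cdots+b_k: b_i\in B \text{ for } 1\le i\le k\}$ (repetitions allowed). For $s\in\mathbb{Z}_n$, $m(k,n;s)=\max\{|B|: B\subset\mathbb{Z}_n,\ s\notin kB\}$ (the empty set is allowed, with empty sumset). $\lfloor\cdot\rfloor$ is the floor function (so $\lfloor -1/k\rfloor=-1$). *)

(* Defs.v *)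
From HB Require Import structures.
From mathcomp Require Import all_boot all_order all_algebra.

Set Implicit Arguments.
Unset Strict Implicit.
Unset Printing Implicit Defensive.

Import Order.TTheory GRing.Theory Num.Theory.
Local Open Scope ring_scope.

(* Z/nZ for every n > 0: MathComp's 'Z_n is Z/2Z when n = 1, whereas 'I_p.+1
   is an additive group of order p.+1 for every p. *)
Definition Zmod (n : nat) : finZmodType := 'I_n.-1.+1.

Definition sumset (V : finZmodType) (k : nat) (B : {set V}) : {set V} :=
  [set \sum_i f i | f : {ffun 'I_k -> V} in ffun_on (mem B)].

Definition maxavoid (k n : nat) (s : Zmod n) : nat :=
  \max_(B : {set Zmod n} | s \notin sumset k B) #|B|.

(* divz by k > 0 rounds towards minus infinity, so the factor is 0 at d = 1. *)
Definition divisor_term (k n d : nat) : int :=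
  (((d%:Z - 2) %/ k%:Z)%Z + 1) * (n %/ d)%N%:Z.

(* For n > 0 the divisor d = 1 contributes the value 0, so the initial value 0
   does not alter the maximum. *)
Definition max_divisor_term (k n : nat) : int :=
  \big[Num.max/0]_(d <- divisors n) divisor_term k n d.

(* Main.v *)
Require Import Defs.
From HB Require Import structures.
From mathcomp Require Import all_boot all_order all_algebra.
From mathcomp Require Import all_fingroup zify.
Import Order.TTheory GRing.Theory Num.Theory.

(** The upper bound is Kneser's theorem for the k-fold sumset: if H is the
    stabilizer of kB, then |kB| >= k |B+H| - (k-1) |H|; when kB misses a point it
    misses a whole coset of H, so with d the index of H the set B meets at most
    floor((d-2)/k) + 1 cosets of H.  Kneser's theorem for two summands is proved
    by his own argument: by Dyson transforms every point of A+B lies in some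
    C included in A+B with |C| + |stab C| >= |A| + |B|, and this inequality is
    inherited by unions.  For the lower bound, take the preimage in Z_n of an
    interval of floor((d-2)/k) + 1 residues modulo d, translated so that s becomes
    the residue d-1; the translation exists because k is invertible modulo n. *)

(** * Stabilizers, cosets and sizes of products *)

Section Stabilizer.

Local Open Scope group_scope.

Variable gT : finGroupType.
Implicit Types (A B C S T : {set gT}) (H K : {group gT}).

Definition stab A := [set x : gT | x *: A == A].

Lemma stab_group_set A : group_set (stab A).
Proof.
apply/group_setP; split=> [|x y]; first by rewrite inE lcoset1.
by rewrite !inE => /eqP xA /eqP yA; rewrite lcosetM yA xA.
Qed.

Canonical stab_group A := Group (stab_group_set A).

Lemma mul_stab A : stab A * A = A.
Proof.
apply/eqP; rewrite eqEsubset mulG_subr andbT.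
apply/subsetP=> _ /mulsgP[x a + aA ->]; rewrite inE => /eqP <-.
by rewrite mem_lcoset mulKg.
Qed.

Lemma sub_stab H A : H * A \subset A -> H \subset stab A.
Proof.
move=> /subsetP sHA; apply/subsetP=> x xH.
rewrite inE eqEcard card_lcoset leqnn andbT.
by apply/subsetP=> y /lcosetP[a aA ->]; apply/sHA/mem_mulg.
Qed.

Lemma stab_mulr A B : stab A \subset stab (A * B).
Proof. by apply: sub_stab; rewrite mulgA mul_stab. Qed.

Lemma mulG_stable H A x y : H * A = A -> x \in H -> (x * y \in A) = (y \in A).
Proof.
move=> HA xH; apply/idP/idP=> [xyA | yA]; rewrite -HA.
  by rewrite -(mulKg x y) mem_mulg ?groupV.
exact: mem_mulg.
Qed.

Lemma leq_card_mulG_stable H A : H * A = A -> A != set0 -> #|H| <= #|A|.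
Proof.
move=> HA /set0Pn[a aA]; rewrite -(card_rcoset H a).
by apply/subset_leq_card/subsetP=> _ /rcosetP[x xH ->]; rewrite (mulG_stable _ _ _ _ HA).
Qed.

Lemma dvdn_card_mulG_stable H A : H * A = A -> #|H| %| #|A|.
Proof.
move=> HA; have := preim_partitionP (fun x => H :* x) A.
move/(card_uniform_partition (n := #|H|)) => -> //; first exact: dvdn_mull.
move=> _ /imsetP[x xA ->]; rewrite -(card_rcoset H x); apply: eq_card => y.
rewrite inE eq_sym (sameP eqP (rcoset_eqP (x := y) (y := x))) andb_idl //.
by case/rcosetP=> h hH ->; rewrite (mulG_stable _ _ _ _ HA).
Qed.

(** Two factorizations of z with left factor in S and right factor in T differ by an element of
    [H :&: K], so each fibre of the product map has at most [#|H :&: K|] points. *)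
Lemma leq_card_mulg_fibers H K S T :
  S \subset H -> T \subset K -> #|S| * #|T| <= #|S * T| * #|H :&: K|.
Proof.
move=> /subsetP sSH /subsetP sTK.
(* [r z] is a reference left factor of z; the default 1 is never reached on [S * T]. *)
pose r z := odflt 1 [pick s in S | s^-1 * z \in T].
have rP s t : s \in S -> t \in T -> (r (s * t) \in S) && ((r (s * t))^-1 * (s * t) \in T).
  move=> sS tT; rewrite /r; case: pickP => [//|/(_ s)].
  by rewrite sS mulKg tT.
rewrite -!cardsX.
pose f (p : gT * gT) := (p.1 * p.2, (r (p.1 * p.2))^-1 * p.1).
rewrite -(@card_in_imset _ _ f); last first.
  move=> [s t] [s' t'] _ _ /= [/= Est]; rewrite Est => /mulgI Es.
  by move: Est; rewrite Es => /mulgI ->.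
apply/subset_leq_card/subsetP=> _ /imsetP[[s t] /setXP[/= sS tT] ->].
rewrite inE /= mem_mulg //= inE.
have /andP[rS rT] := rP s t sS tT.
apply/andP; split; first by rewrite groupM ?groupV ?sSH.
by rewrite -{2}(mulgK t s) mulgA groupM ?groupV ?sTK.
Qed.

(** Let l be [#|H :&: K|]. Stability gives |S|, |T| >= l; expanding (|S| - l)(|T| - l) >= 0 and
    using |S||T| <= l|ST| yields l times the claim. *)
Lemma card_mulg_grid H K S T :
    S \subset H -> T \subset K -> S != set0 -> T != set0 ->
    (H :&: K) * S = S -> (H :&: K) * T = T ->
  #|S| + #|T| <= #|S * T| + #|H :&: K|.
Proof.
move=> sSH sTK S0 T0 LS LT.
have := leq_card_mulG_stable _ _ LS S0; have := leq_card_mulG_stable _ _ LT T0.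
have := leq_card_mulg_fibers _ _ _ _ sSH sTK; have := cardG_gt0 (H :&: K)%G.
set l := #|_ :&: _|; move=> l0 le1 le2 le3; nia.
Qed.

(** * Unions of stable sets in a commutative group *)

Hypothesis cG : forall x y : gT, x * y = y * x.

Lemma mulsgC A B : A * B = B * A.
Proof.
by apply/setP=> x; apply/mulsgP/mulsgP=> [] [a b aA bB ->]; exists b a.
Qed.

(* In the coset c (H1 H2), C1 consists of cosets of H1 and C2 of cosets of H2, so
   both differences C2 \ C1 and C1 \ C2 contain a product S T as in
   card_mulg_grid. *)
Lemma stable_unionW H1 H2 C1 C2 :
    H1 * C1 = C1 -> H2 * C2 = C2 -> ~~ (C2 \subset C1) -> #|H1| <= #|H2| ->
  (#|C1| + #|H1| <= #|C1 :|: C2| + #|H1 :&: H2|)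
  || (#|C2| + #|H2| <= #|C1 :|: C2| + #|H1 :&: H2|).
Proof.
move=> E1 E2 /subsetPn[c c2 c1] leH.
have key S T C D : S \subset H1 -> T \subset H2 -> S != set0 -> T != set0 ->
    (H1 :&: H2) * S = S -> (H1 :&: H2) * T = T ->
    (forall x y, x \in S -> y \in T -> x * y * c \in C :\: D) ->
    #|S| + #|T| <= #|C :\: D| + #|H1 :&: H2|.
  move=> sS sT S0 T0 KS KT sCD.
  apply: leq_trans (card_mulg_grid _ _ _ _ sS sT S0 T0 KS KT) _.
  rewrite leq_add2r -(card_rcoset (S * T) c); apply/subset_leq_card/subsetP=> z.
  by case/rcosetP=> _ /mulsgP[x y xS yT ->] ->; apply: sCD.
have stable H (P : pred gT) : H1 :&: H2 \subset H ->
    (forall x y : gT, x \in H1 :&: H2 -> P (x * y) = P y) ->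
    (H1 :&: H2) * [set h in H | P h] = [set h in H | P h].
  move=> /subsetP sKH stP; apply/eqP; rewrite eqEsubset mulG_subr andbT.
  apply/subsetP=> _ /mulsgP[x y xK + ->]; rewrite !inE => /andP[yH Py].
  by rewrite groupM ?(sKH x) //= stP.
have st1 x y : x \in H1 :&: H2 -> (x * y * c \in C1) = (y * c \in C1).
  by rewrite -mulgA => /setIP[xH _]; apply: mulG_stable E1 xH.
have st2 x y : x \in H1 :&: H2 -> (x * y * c \in C2) = (y * c \in C2).
  by rewrite -mulgA => /setIP[_ xH]; apply: mulG_stable E2 xH.
pose S := [set h in H1 | h * c \in C2]; pose S' := [set h in H1 | h * c \notin C2].
pose T := [set h in H2 | h * c \notin C1]; pose T' := [set h in H2 | h * c \in C1].
have sub (H : {group gT}) (P : pred gT) : [set h in H | P h] \subset H.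
  by apply/subsetP=> h; rewrite inE => /andP[].
have cardS : #|S| + #|S'| = #|H1|.
  rewrite -(cardsID [set h | h * c \in C2] H1); congr (_ + _); apply: eq_card => h.
    by rewrite !inE.
  by rewrite !inE andbC.
have cardT : #|T'| + #|T| = #|H2|.
  rewrite -(cardsID [set h | h * c \in C1] H2); congr (_ + _); apply: eq_card => h.
    by rewrite !inE.
  by rewrite !inE andbC.
have cU1 : #|C1 :|: C2| = #|C1| + #|C2 :\: C1|.
  by have := cardsUI C1 C2; have := cardsID C1 C2; rewrite setIC; lia.
have cU2 : #|C1 :|: C2| = #|C2| + #|C1 :\: C2|.
  by have := cardsUI C1 C2; have := cardsID C2 C1; lia.
have S0 : S != set0 by apply/set0Pn; exists 1; rewrite inE group1 mul1g.
have T0 : T != set0 by apply/set0Pn; exists 1; rewrite inE group1 mul1g.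
have KS : (H1 :&: H2) * S = S by apply: stable (subsetIl _ _) _.
have KT : (H1 :&: H2) * T = T.
  by apply: stable (subsetIr _ _) _ => x y xK; rewrite st1.
have KS' : (H1 :&: H2) * S' = S'.
  by apply: stable (subsetIl _ _) _ => x y xK; rewrite st2.
have KT' : (H1 :&: H2) * T' = T' by apply: stable (subsetIr _ _) _.
have le1 : #|S| + #|T| <= #|C2 :\: C1| + #|H1 :&: H2|.
  apply: key (sub _ _) (sub _ _) S0 T0 KS KT _ => x y.
  rewrite !inE => /andP[xH xc] /andP[yH yc].
  rewrite -mulgA (mulG_stable _ _ _ _ E1) // yc /=.
  by rewrite mulgA (cG x) -mulgA (mulG_stable _ _ _ _ E2).
(* If |S'| <= |T|, then |H1| <= |S| + |T| and [le1] gives the first alternative. Otherwise |S'| +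
   |T'| > |H2|, and |H1| <= |H2| forces T' to be nonempty, so the second alternative follows. *)
have [leS | ltS] := leqP #|S'| #|T|.
  by apply/orP; left; lia.
have T'0 : T' != set0 by rewrite -card_gt0; lia.
have S'0 : S' != set0 by rewrite -card_gt0; lia.
have le2 : #|S'| + #|T'| <= #|C1 :\: C2| + #|H1 :&: H2|.
  apply: key (sub _ _) (sub _ _) S'0 T'0 KS' KT' _ => x y.
  rewrite !inE => /andP[xH xc] /andP[yH yc].
  rewrite -[x * y * c]mulgA (mulG_stable _ _ _ _ E1) // yc andbT.
  by rewrite mulgA (cG x) -mulgA (mulG_stable _ _ _ _ E2).
by apply/orP; right; lia.
Qed.

(** If neither set contains the other, [stable_unionW] applies with the smaller stabilizer first,
    and the common stabilizer of C1 and C2 also stabilizes their union. *)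
Lemma stab_union C1 C2 m :
    m <= #|C1| + #|stab C1| -> m <= #|C2| + #|stab C2| ->
  m <= #|C1 :|: C2| + #|stab (C1 :|: C2)|.
Proof.
move=> m1 m2.
have [/setUidPl -> // | n21] := boolP (C2 \subset C1).
have [/setUidPr -> // | n12] := boolP (C1 \subset C2).
have leK : #|stab C1 :&: stab C2| <= #|stab (C1 :|: C2)|.
  apply/subset_leq_card/sub_stab; rewrite mulgU; apply/setUSS.
    by rewrite -{3}(mul_stab C1) mulSg ?subsetIl.
  by rewrite -{3}(mul_stab C2) mulSg ?subsetIr.
suff : (#|C1| + #|stab C1| <= #|C1 :|: C2| + #|stab C1 :&: stab C2|)
    || (#|C2| + #|stab C2| <= #|C1 :|: C2| + #|stab C1 :&: stab C2|).
  by case/orP; lia.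
have [le12 | /ltnW le21] := leqP #|stab C1| #|stab C2|.
  exact: stable_unionW (mul_stab C1) (mul_stab C2) n21 le12.
by rewrite orbC setUC setIC; apply: stable_unionW (mul_stab C2) (mul_stab C1) n12 le21.
Qed.

(** * Kneser's theorem for two factors *)

Lemma kneser_local A B a b : a \in A -> b \in B ->
  exists C, [/\ a * b \in C, C \subset A * B & #|A| + #|B| <= #|C| + #|stab C|].
Proof.
have [n] := ubnP #|B|; elim: n A B => // n IH A B ltB aA bB.
have [all_in | ] := boolP [forall x in A, [forall y in B, x * (y * b^-1) \in A]].
  have AB x y : x \in A -> y \in B -> x * y * b^-1 \in A.
    by move=> xA yB; rewrite -mulgA; move/forall_inP/(_ x xA)/forall_inP/(_ y yB): all_in.
  (* Here [A * B] is just [A :* b], and [B :* b^-1] lies in its stabilizer. *)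
  exists (A * B); split=> //; first exact: mem_mulg.
  have eAB : A * B = A :* b.
    apply/setP=> z; rewrite mem_rcoset; apply/idP/idP=> [/mulsgP[x y xA yB ->] | zA].
      exact: AB.
    by rewrite -(mulgKV b z) mem_mulg.
  rewrite leq_add //; first by rewrite eAB card_rcoset.
  rewrite -(card_rcoset B b^-1); apply/subset_leq_card/subsetP=> _ /rcosetP[y yB ->].
  rewrite inE eqEcard card_lcoset leqnn andbT eAB.
  apply/subsetP=> _ /lcosetP[_ /rcosetP[x xA ->] ->].
  by rewrite mem_rcoset mulgA mulgK (cG _ x) mulgA AB.
case/forall_inPn=> x xA /forall_inPn[y yB xyA].
(* With this e, b e = x is in A, so b stays in B', while y e = x y b^-1 is not in A, so y leaves and
   the induction advances. *)
pose e := b^-1 * x.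
pose A' := A :|: B :* e; pose B' := B :&: A :* e^-1.
have ltB' : #|B'| < #|B|.
  apply/proper_card/properP; split; first exact: subsetIl.
  exists y => //; apply: contra xyA; rewrite inE mem_rcoset invgK => /andP[_].
  by rewrite /e (cG x) mulgA.
have aA' : a \in A' by rewrite inE aA.
have bB' : b \in B' by rewrite inE bB mem_rcoset invgK /e mulKVg.
have [C [abC sC le]] := IH A' B' (leq_trans ltB' ltB) aA' bB'.
exists C; split=> //.
  apply: subset_trans sC _; apply/subsetP=> _ /mulsgP[u v uA /setIP[vB vA] ->].
  case/setUP: uA => [uA | ]; first exact: mem_mulg.
  case/rcosetP=> w wB ->; move: vA; rewrite mem_rcoset invgK => vA.
  by rewrite -mulgA (cG e) (cG w) mem_mulg.
suff <- : #|A'| + #|B'| = #|A| + #|B| by [].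
rewrite -(card_rcoset B e) -(cardsUI A); congr (_ + _).
rewrite -(card_rcoset B' e); apply: eq_card => z.
by rewrite !(inE, mem_rcoset) invgK mulgKV andbC.
Qed.

(** A maximal subset of [A * B] satisfying the inequality absorbs, by [stab_union], the local set at
    every point, so it is all of [A * B]. *)
Lemma kneserW A B : A != set0 -> B != set0 ->
  #|A| + #|B| <= #|A * B| + #|stab (A * B)|.
Proof.
case/set0Pn=> a aA /set0Pn[b bB].
pose P := [pred C : {set gT} | (C \subset A * B) && (#|A| + #|B| <= #|C| + #|stab C|)].
have [C0 [_ sC0 leC0]] := kneser_local _ _ _ _ aA bB.
have [|C /maxsetP[/andP[sC leC] maxC] _] := @maxset_exists _ P C0.
  by rewrite /= sC0.
suff <- : C = A * B by [].
apply/eqP; rewrite eqEsubset sC; apply/subsetP=> _ /mulsgP[x y xA yB ->].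
have [D [xyD sD leD]] := kneser_local _ _ _ _ xA yB.
rewrite -(maxC (C :|: D)) ?subsetUl //; first by rewrite inE xyD orbT.
by rewrite /= subUset sC sD stab_union.
Qed.

Theorem kneser A B (H := stab (A * B)) : A != set0 -> B != set0 ->
  #|A * H| + #|B * H| <= #|A * B| + #|H|.
Proof.
move=> A0 B0.
have nz X : X != set0 -> X * H != set0.
  by case/set0Pn=> x xX; apply/set0Pn; exists (x * 1); rewrite mem_mulg ?group1.
have E : (A * H) * (B * H) = A * B.
  rewrite (mulsgC B) mulgA -(mulgA A) mulGid (mulsgC A H) -mulgA; exact: mul_stab.
by have := kneserW _ _ (nz _ A0) (nz _ B0); rewrite E.
Qed.

(** * Kneser's bound for k-fold products *)

Lemma kneser_expg k B (H := stab (B ^+ k.+1)) : B != set0 ->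
  k.+1 * #|B * H| <= #|B ^+ k.+1| + k * #|H|.
Proof.
rewrite /H {H}; elim: k B => [|k IH] B B0.
  by rewrite expg1 mulsgC mul_stab mul1n mul0n addn0.
(* The induction hypothesis is applied to [B * H] rather than B: the stabilizer of [B ^+ k.+1] may
   be smaller than H, but that of [(B * H) ^+ k.+1] is exactly H. *)
set H := stab_group (B ^+ k.+2).
have nz (X Y : {set gT}) : X != set0 -> Y != set0 -> X * Y != set0.
  by case/set0Pn=> x xX /set0Pn[y yY]; apply/set0Pn; exists (x * y); rewrite mem_mulg.
have H0 : (H : {set gT}) != set0 by apply/set0Pn; exists 1; apply: group1.
have X0 j : B ^+ j.+1 != set0.
  by elim: j => [|j IHj]; rewrite ?expg1 // expgS nz.
have eH : (B * H) ^+ k.+1 = B ^+ k.+1 * H.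
  have HX j : (H : {set gT}) ^+ j.+1 = H.
    by elim: j => [|j IHj]; rewrite ?expg1 // expgS IHj mulGid.
  by rewrite expgMn ?HX //; apply: mulsgC.
have BHk : B ^+ k.+1 * H * B = B ^+ k.+2.
  by rewrite -mulgA (mulsgC H) mulgA -expgSr mulsgC mul_stab.
have sH : stab (B ^+ k.+1 * H) = H.
  apply/eqP; rewrite eqEsubset; apply/andP; split.
    by have := stab_mulr (B ^+ k.+1 * H) B; rewrite BHk.
  by apply: sub_stab; rewrite mulsgC -mulgA mulGid.
have := IH (B * H) (nz _ _ B0 H0); rewrite eH sH -mulgA mulGid => le1.
have := kneser (B ^+ k.+1) B (X0 k) B0; rewrite -expgSr => le2.
have {}le2 : #|B ^+ k.+1 * H| + #|B * H| <= #|B ^+ k.+2| + #|H| := le2.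
have {}le1 : k.+1 * #|B * H| <= #|B ^+ k.+1 * H| + k * #|H| := le1.
change (k.+2 * #|B * H| <= #|B ^+ k.+2| + k.+1 * #|H|).
move: le1 le2; move: #|B * H| #|B ^+ k.+1 * H| #|B ^+ k.+2| #|H| => x y z h; lia.
Qed.

(** Here d is the index of H and b the number of cosets of H met by B; the middle condition is b <=
    floor((d-2)/(k+1)) + 1 without subtraction. *)
Lemma card_noncovering_expg k B : B != set0 -> B ^+ k.+1 != [set: gT] ->
  exists d b, [/\ d %| #|gT|, k.+1 * b + 2 <= d + k.+1 & #|B| <= b * (#|gT| %/ d)].
Proof.
move=> B0 BT; set H := stab_group (B ^+ k.+1).
have /dvdnP[b cBH] : #|H| %| #|B * H|.
  by apply: dvdn_card_mulG_stable; rewrite (mulsgC H) -mulgA mulGid.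
have cG0 : #|gT| = (#|[set: gT] : H| * #|H|)%N.
  by rewrite mulnC Lagrange ?subsetT // cardsT.
exists #|[set: gT] : H|, b; split.
- by rewrite cG0 dvdn_mulr.
(* The complement is a nonempty union of cosets of H. *)
- have leH : #|H| <= #|~: (B ^+ k.+1)|.
    apply: leq_card_mulG_stable; last by rewrite -(inj_eq (@setC_inj _)) setCK setC0.
    apply/eqP; rewrite eqEsubset mulG_subr andbT.
    apply/subsetP=> _ /mulsgP[x y xH + ->]; rewrite !inE.
    by rewrite (mulG_stable H _ _ _ _ xH) //; apply: mul_stab.
  have le1 : k.+1 * #|B * H| <= #|B ^+ k.+1| + k * #|H| := kneser_expg k B B0.
  rewrite cBH in le1.
  have := cardsC (B ^+ k.+1); rewrite cG0 => eC.
  have H0 := cardG_gt0 H.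
  suff : (k.+1 * b + 2) * #|H| <= (#|[set: gT] : H| + k.+1) * #|H|.
    by rewrite leq_pmul2r.
  move: leH le1 eC; move: #|~: _| #|B ^+ k.+1| #|H| #|_ : _| => u v h i; lia.
- rewrite cG0 mulKn ?indexg_gt0 // -cBH.
  by apply/subset_leq_card/mulG_subl.
Qed.

End Stabilizer.

(** * Sumsets in Z_n and the extremal sets *)

Local Open Scope ring_scope.

(** The group product of a [finZmodType] is its addition, so the multiplicative results transfer. *)
Lemma sumset_expg p k (B : {set Zmod p.+1}) : sumset k B = (B ^+ k)%g.
Proof.
have -> : (B ^+ k)%g = (\prod_(i < k) B)%g.
  by rewrite prodg_const card_ord.
apply/setP=> x; apply/imsetP/prodsgP=> [[f /ffun_onP fB ->] | [c cB ->]].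
  by exists f.
exists [ffun i => c i]; first by apply/ffun_onP=> i; rewrite ffunE cB.
by apply: eq_bigr => i _; rewrite ffunE.
Qed.

Lemma val_sum_modn p (I : finType) (f : I -> 'I_p.+1) :
  (val (\sum_i f i)%R = \sum_i val (f i) %[mod p.+1])%N.
Proof.
elim/big_rec2: _ => // i y x _ IH.
by rewrite /= modn_mod -modnDmr IH modnDmr.
Qed.

Lemma avoiding_residues k p d q (s : Zmod p.+1) :
    (0 < k)%N -> coprime k p.+1 -> (d %| p.+1)%N -> (k * q + 2 <= d)%N ->
  exists2 B : {set Zmod p.+1},
    s \notin sumset k B & (q.+1 * (p.+1 %/ d) <= #|B|)%N.
Proof.
set n := p.+1 => k0 co dn leq.
have [t Et] : exists t, (val s + k * t = d.-1 %[mod d])%N.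
  case: (egcdnP n k0) => u v Euv _; move: Euv; rewrite (eqP co) => Euv.
  (* u inverts k modulo n, and [n - val s] stands for -s. *)
  exists (u * (d.-1 + (n - val s)))%N.
  have sn : (val s < n)%N by apply: ltn_ord.
  have [m En] := dvdnP dn.
  have -> : (val s + k * (u * (d.-1 + (n - val s))) =
      (m * (v * (d.-1 + (n - val s)) + 1)) * d + d.-1)%N.
    rewrite mulnA (mulnC k) Euv; move: sn; rewrite En; nia.
  by rewrite modnMDl.
exists [set x : Zmod n | (val x + t) %% d <= q]%N.
  apply/negP=> /imsetP[f /ffun_onP fB Es].
  have le : (\sum_(i < k) (val (f i) + t) %% d <= k * q)%N.
    rewrite -[k in (k * q)%N]card_ord -sum_nat_const leq_sum // => i _.
    by have := fB i; rewrite inE.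
  have : (\sum_(i < k) (val (f i) + t) %% d = d.-1 %[mod d])%N.
    rewrite modn_summ big_split /= sum_nat_const card_ord -Et Es.
    rewrite -(modn_dvdm _ dn) -[RHS](modn_dvdm _ dn) -modnDml.
    by rewrite -[in RHS]modnDml (val_sum_modn p).
  (* The sum of residues is at most k q <= d - 2, so it cannot be congruent to d - 1. *)
  rewrite !modn_small; lia.
(* [t * p] represents -t modulo [p.+1], so g enumerates the shifted elements i + j d - t. *)
pose g (u : 'I_q.+1 * 'I_(n %/ d)) : 'I_n := inZp (u.1 + u.2 * d + t * p).
have d0 : (0 < d)%N by lia.
have ltd (i : 'I_q.+1) : (i < d)%N by have := ltn_ord i; nia.
have ltn (i : 'I_q.+1) (j : 'I_(n %/ d)) : (i + j * d < n)%N.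
  have := divnK dn; have := ltd i; have := ltn_ord j.
  move: (nat_of_ord i) (nat_of_ord j) => a b.
  by move: (n %/ d)%N => m; nia.
have g_inj : injective g.
  move=> [i j] [i' j'] /(congr1 val) /= /eqP; rewrite eqn_modDr !modn_small ?ltn //.
  move=> /eqP E.
  have Ei : i = i' :> nat.
    by move: (congr1 (modn^~ d) E); rewrite !(addnC _ (_ * _)%N) !modnMDl !modn_small.
  have Ej : j = j' :> nat.
    by move: E; rewrite Ei => /addnI/eqP; rewrite eqn_pmul2r // => /eqP.
  by rewrite (val_inj Ei) (val_inj Ej).
have -> : (q.+1 * (n %/ d) = #|[set: 'I_q.+1 * 'I_(n %/ d)]|)%N.
  by rewrite cardsT card_prod !card_ord.
rewrite -(card_imset _ g_inj); apply/subset_leq_card/subsetP=> _ /imsetP[[i j] _ ->].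
rewrite inE /= -modnDml modn_dvdm // modnDml -addnA -mulnSr (addnC (nat_of_ord i)).
have /eqP tn0 : (t * p.+1 %% d == 0)%N by apply: dvdn_mull.
by rewrite -addnA modnMDl -modnDmr tn0 addn0 modn_small // -ltnS.
Qed.

(** * Comparison with the divisor formula *)

Lemma ge_divisor_term k n d b : (0 < k)%N -> (k * b + 2 <= d + k)%N ->
  ((b * (n %/ d))%N%:Z <= divisor_term k n d)%R.
Proof.
move=> k0 le; rewrite /divisor_term PoszM ler_wpM2r // -lerBlDr lez_divRL //; lia.
Qed.

Theorem corollary3p2 (k n : nat) (hk : (2 <= k)%N) (hn : (0 < n)%N)
  (hkn : coprime k n) (s : Zmod n) :
  (maxavoid k s)%:Z = max_divisor_term k n.
Proof.
case: n hn hkn s => // p _ co s; apply/eqP; rewrite eq_le; apply/andP; split.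
  have M0 : 0 <= max_divisor_term k p.+1 by apply: bigmax_ge_id.
  rewrite -(gez0_abs M0) lez_nat; apply/bigmax_leqP=> B sB.
  rewrite -lez_nat gez0_abs //.
  have [-> | B0] := eqVneq B set0; first by rewrite cards0.
  case: k hk {co M0} sB => // k _; rewrite sumset_expg => sB.
  have BT : (B ^+ k.+1)%g != [set: 'I_p.+1].
    by apply: contraNneq sB => ->; rewrite inE.
  have [|d [b [dn le leB]]] := @card_noncovering_expg 'I_p.+1 _ k B B0 BT.
    exact: addrC.
  move: dn leB; rewrite card_ord => dn leB.
  apply: (bigmax_sup_seq _ d) => //; first by rewrite -dvdn_divisors.
  by apply: le_trans (ge_divisor_term _ _ _ _ _ le) => //; rewrite lez_nat.
rewrite /max_divisor_term big_seq; apply: bigmax_le => // d.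
rewrite -dvdn_divisors // => dn.
have d0 : (0 < d)%N := dvdn_gt0 (ltn0Sn p) dn.
have k0 : (0 < k)%N by lia.
(* The case d = 1 is separate: floor(-1/k) = -1 makes the term 0, whereas [d - 2] in nat would
   truncate to 0. *)
have [d1 | d2] := leqP d 1.
  have -> : d = 1%N by lia.
  have -> : divisor_term k p.+1 1 = 0.
    by rewrite /divisor_term (divNz_nat 0) // div0n mul0r.
  by [].
have [|B sB leB] := avoiding_residues k p d ((d - 2) %/ k) s k0 co dn.
  by have := leq_trunc_div (d - 2) k; lia.
have -> : divisor_term k p.+1 d = (((d - 2) %/ k).+1 * (p.+1 %/ d))%N%:Z.
  rewrite /divisor_term.
  have -> : (d%:Z - 2 = (d - 2)%N%:Z)%R by lia.
  by rewrite divz_nat PoszM (intS ((d - 2) %/ k)) (addrC 1).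
rewrite lez_nat; apply: leq_trans leB _.
exact: (leq_bigmax_cond (F := fun B : {set Zmod p.+1} => #|B|)).
Qed.
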